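(* Every (un-typed) $\lambda\mu$-term is strongly normalizing for the $\mu\mu'$-reduction; that is, there is no infinite sequence of $\mu\mu'$-reduction steps starting from any $\lambda\mu$-term.
   Context: $\lambda\mu$-terms are generated by the grammar $t ::= x \mid \lambda x\, t \mid (t\; t) \mid \mu\alpha\, t \mid (\alpha\; t)$, where $x,y,\dots$ are $\lambda$-variables and $\alpha,\beta,\dots$ are $\mu$-variables (two disjoint infinite sets); $\lambda x$ and $\mu\alpha$ are binders, terms are considered up to renaming of bound variables and substitutions are capture-avoiding. $M[\alpha=_rN]$ is the term obtained from $M$ by replacing (recursively) each sub-term of the form $(\alpha\; U)$, $\alpha$ free, by $(\alpha\; (U\; N))$; $M[\alpha=_lN]$ is obtained by replacing (recursively) each such sub-term $(\alpha\; U)$ by $(\alpha\; (N\; U))$. The $\mu\mu'$-reduction is the closure under all term constructors of the two rules $(\mu\alpha M\; N)\triangleright \mu\alpha\, M[\alpha=_rN]$ (rule $\mu$) and $(M\;\mu\alpha N)\triangleright\mu\alpha\, N[\alpha=_lM]$ (rule $\mu'$). No typing is assumed and the $\beta$-rule is not included. *)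

(* Defs.v *)
From Stdlib Require Import Arith.

(** Terms modulo renaming of bound variables, in de Bruijn form.  Lambda- and
    mu-variables are numbered independently: [Lam] binds the lambda-variable 0
    of its body and [Mu] binds the mu-variable 0 of its body.  Indices pointing
    outside the term are free variables. *)
Inductive term : Type :=
| Var : nat -> term
| Lam : term -> term
| App : term -> term -> term
| Mu : term -> term
| Name : nat -> term -> term.

(** [lift_lam k t] (resp. [lift_mu k t]) increments the lambda-variables
    (resp. mu-variables) of [t] that are [>= k]. *)
Fixpoint lift_lam (k : nat) (t : term) : term :=
  match t with
  | Var x => Var (if x <? k then x else S x)
  | Lam u => Lam (lift_lam (S k) u)
  | App u v => App (lift_lam k u) (lift_lam k v)
  | Mu u => Mu (lift_lam k u)
  | Name a u => Name a (lift_lam k u)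
  end.

Fixpoint lift_mu (k : nat) (t : term) : term :=
  match t with
  | Var x => Var x
  | Lam u => Lam (lift_mu k u)
  | App u v => App (lift_mu k u) (lift_mu k v)
  | Mu u => Mu (lift_mu (S k) u)
  | Name a u => Name (if a <? k then a else S a) (lift_mu k u)
  end.

(** [subst_r a N M] is M[a =_r N] and [subst_l a N M] is M[a =_l N].  The
    mu-variable [a] is not eliminated, so no index of [M] is decremented; [N]
    lives in the same context as [M]. *)
Fixpoint subst_r (a : nat) (N M : term) : term :=
  match M with
  | Var x => Var x
  | Lam u => Lam (subst_r a (lift_lam 0 N) u)
  | App u v => App (subst_r a N u) (subst_r a N v)
  | Mu u => Mu (subst_r (S a) (lift_mu 0 N) u)
  | Name b u =>
      if b =? a then Name b (App (subst_r a N u) N)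
      else Name b (subst_r a N u)
  end.

Fixpoint subst_l (a : nat) (N M : term) : term :=
  match M with
  | Var x => Var x
  | Lam u => Lam (subst_l a (lift_lam 0 N) u)
  | App u v => App (subst_l a N u) (subst_l a N v)
  | Mu u => Mu (subst_l (S a) (lift_mu 0 N) u)
  | Name b u =>
      if b =? a then Name b (App N (subst_l a N u))
      else Name b (subst_l a N u)
  end.

(** In both rules the argument is moved under the binder [Mu], hence lifted. *)
Inductive red : term -> term -> Prop :=
| red_mu : forall M N, red (App (Mu M) N) (Mu (subst_r 0 (lift_mu 0 N) M))
| red_mu' : forall M N, red (App M (Mu N)) (Mu (subst_l 0 (lift_mu 0 M) N))
| red_Lam : forall t t', red t t' -> red (Lam t) (Lam t')
| red_App_l : forall t t' u, red t t' -> red (App t u) (App t' u)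
| red_App_r : forall t u u', red u u' -> red (App t u) (App t u')
| red_Mu : forall t t', red t t' -> red (Mu t) (Mu t')
| red_Name : forall a t t', red t t' -> red (Name a t) (Name a t').

Definition strongly_normalizing (t : term) : Prop :=
  ~ exists f : nat -> term, f 0 = t /\ forall n : nat, red (f n) (f (S n)).

(* Main.v *)
From Stdlib Require Import Arith List Relations Wellfounded.
Import ListNotations.
Require Import Defs.

(** The main point is that [App M N] is strongly normalizing as soon as [M] and
    [N] are.  Let [<] be the transitive closure of "reduct or immediate subterm";
    it is well-founded below a strongly normalizing term.  By recursion on [<],
    a one-hole application frame [F] (either [(_ N)] or [(N _)]) is good for [a]
    when [F[a s]] is strongly normalizing for every substitution [s] whose frames
    are all good for every [a' < a].  If the frames of [s] are good below [a],
    then [a s] is strongly normalizing.  The claim that [(a s  b r)] is strongly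
    normalizing whenever the frames of [s] are good below [a] and those of [r]
    below [b] is proved by induction on the pair [(a, b)]: if [a s] reduces to
    [mu P], then [a] reduces to some [mu Q] with [Q s] reducing to [P], and the
    contractum is a reduct of [Q] under [s] extended by the frame [(_ (b r))],
    which is good below [a] because of the induction hypothesis for the pairs
    [(a', b)] with [a' < a].  The other side is symmetric. *)

(** * Renamings and substitutions *)

Inductive frame : Type :=
| ArgR : term -> frame
| ArgL : term -> frame.

Definition fill (F : frame) (t : term) : term :=
  match F with ArgR N => App t N | ArgL N => App N t end.

Definition map_frame (h : term -> term) (F : frame) : frame :=
  match F with ArgR N => ArgR (h N) | ArgL N => ArgL (h N) end.

Definition plug (l : list frame) (t : term) : term :=
  fold_left (fun u F => fill F u) l t.

Definition up (f : nat -> nat) (n : nat) : nat :=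
  match n with 0 => 0 | S m => S (f m) end.

Fixpoint ren (f g : nat -> nat) (t : term) : term :=
  match t with
  | Var x => Var (f x)
  | Lam u => Lam (ren (up f) g u)
  | App u v => App (ren f g u) (ren f g v)
  | Mu u => Mu (ren f (up g) u)
  | Name a u => Name (g a) (ren f g u)
  end.

(** A mu-substitution renames each mu-variable and attaches to it the list of
    frames to be put around its arguments; lists, rather than single frames, make
    substitutions closed under composition. *)
Definition musubst : Type := nat -> nat * list frame.

Definition ren_musubst (f g : nat -> nat) (s : musubst) : musubst :=
  fun a => (g (fst (s a)), map (map_frame (ren f g)) (snd (s a))).

Definition up_lam (s : musubst) : musubst := ren_musubst S (fun a => a) s.

Definition up_mu (s : musubst) : musubst := fun a =>
  match a with
  | 0 => (0, [])
  | S b => ren_musubst (fun x => x) S s b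
  end.

Fixpoint inst (f : nat -> nat) (s : musubst) (t : term) : term :=
  match t with
  | Var x => Var (f x)
  | Lam u => Lam (inst (up f) (up_lam s) u)
  | App u v => App (inst f s u) (inst f s v)
  | Mu u => Mu (inst f (up_mu s) u)
  | Name a u => Name (fst (s a)) (plug (snd (s a)) (inst f s u))
  end.

(** [extend s F] goes under a binder [Mu] and attaches [F] to the bound variable. *)
Definition extend (s : musubst) (F : frame) : musubst := fun a =>
  match a with
  | 0 => (0, [map_frame (ren (fun x => x) S) F])
  | S _ => up_mu s a
  end.

Definition id_musubst : musubst := fun a => (a, []).

(** The common form of both rules: the new body after a [Mu] with body [t] meets [F]. Since the
    binder survives, mu-variable 0 stays 0. *)
Definition contract (F : frame) (t : term) : term :=
  inst (fun x => x) (extend id_musubst F) t.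

Lemma up_id f : (forall x, f x = x) -> forall x, up f x = x.
Proof. intros H [|x]; simpl; auto. Qed.

Lemma up_comp f g h :
  (forall x, h x = f (g x)) -> forall x, up h x = up f (up g x).
Proof. intros H [|x]; simpl; auto. Qed.

Lemma map_frame_map h k l :
  map (map_frame h) (map (map_frame k) l) = map (map_frame (fun t => h (k t))) l.
Proof. rewrite map_map. apply map_ext. intros []; reflexivity. Qed.

Lemma map_frame_ext h k l :
  (forall t, h t = k t) -> map (map_frame h) l = map (map_frame k) l.
Proof. intros H. apply map_ext. intros []; simpl; now rewrite H. Qed.

Lemma plug_app l1 l2 t : plug (l1 ++ l2) t = plug l2 (plug l1 t).
Proof. apply fold_left_app. Qed.

(** Renamings and substitutions are compared pointwise here and below: equality of functions would
    not pass under binders without extensionality. *)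
Lemma ren_id t : forall f g,
  (forall x, f x = x) -> (forall a, g a = a) -> ren f g t = t.
Proof. induction t; simpl; intros; f_equal; auto using up_id. Qed.

Lemma ren_ren t : forall f g f1 g1 f2 g2,
  (forall x, f2 x = f (f1 x)) -> (forall a, g2 a = g (g1 a)) ->
  ren f g (ren f1 g1 t) = ren f2 g2 t.
Proof.
  induction t; simpl; intros; f_equal; auto using up_comp.
Qed.

Lemma ren_up_lam f g t :
  ren (up f) g (ren S (fun a => a) t) = ren S (fun a => a) (ren f g t).
Proof.
  rewrite (ren_ren _ _ _ _ _ (fun x => S (f x)) g) by reflexivity.
  symmetry. now apply ren_ren.
Qed.

Lemma ren_up_mu f g t :
  ren f (up g) (ren (fun x => x) S t) = ren (fun x => x) S (ren f g t).
Proof.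
  rewrite (ren_ren _ _ _ _ _ f (fun a => S (g a))) by reflexivity.
  symmetry. now apply ren_ren.
Qed.

Lemma ren_plug f g l t :
  ren f g (plug l t) = plug (map (map_frame (ren f g)) l) (ren f g t).
Proof.
  revert t; induction l as [|[] l IH]; simpl; intros; auto; now rewrite IH.
Qed.

Lemma inst_plug f s l t :
  inst f s (plug l t) = plug (map (map_frame (inst f s)) l) (inst f s t).
Proof.
  revert t; induction l as [|[] l IH]; simpl; intros; auto; now rewrite IH.
Qed.

Lemma inst_ren_nil t : forall f s g,
  (forall a, s a = (g a, [])) -> inst f s t = ren f g t.
Proof.
  induction t; simpl; intros f s g H; f_equal; auto.
  - apply IHt. intros a; unfold up_lam, ren_musubst; now rewrite H.
  - apply IHt. intros [|a]; simpl; auto; unfold ren_musubst; now rewrite H.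
  - now rewrite H.
  - rewrite H; simpl; auto.
Qed.

Lemma inst_ren t : forall f s f1 g1 f2 s2,
  (forall x, f2 x = f (f1 x)) -> (forall a, s2 a = s (g1 a)) ->
  inst f s (ren f1 g1 t) = inst f2 s2 t.
Proof.
  induction t; simpl; intros f s f1 g1 f2 s2 Hf Hs; f_equal; auto.
  - apply IHt; [now apply up_comp|].
    intros a; unfold up_lam, ren_musubst; now rewrite Hs.
  - apply IHt; auto.
    intros [|a]; simpl; auto; unfold ren_musubst; now rewrite Hs.
  - now rewrite Hs.
  - rewrite Hs; f_equal; auto.
Qed.

Lemma ren_inst t : forall f g f1 s1 f2 s2,
  (forall x, f2 x = f (f1 x)) -> (forall a, s2 a = ren_musubst f g s1 a) ->
  ren f g (inst f1 s1 t) = inst f2 s2 t.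
Proof.
  induction t; simpl; intros f g f1 s1 f2 s2 Hf Hs; f_equal; auto.
  - apply IHt; [now apply up_comp|].
    intros a; unfold up_lam, ren_musubst; rewrite Hs; simpl; f_equal.
    rewrite !map_frame_map. apply map_frame_ext. intros; symmetry; apply ren_up_lam.
  - apply IHt; auto.
    intros [|a]; simpl; auto; unfold ren_musubst; rewrite Hs; simpl; f_equal.
    rewrite !map_frame_map. apply map_frame_ext. intros; symmetry; apply ren_up_mu.
  - now rewrite Hs.
  - rewrite ren_plug, Hs; simpl; f_equal; auto.
Qed.

Lemma inst_up_lam f s t :
  inst (up f) (up_lam s) (ren S (fun a => a) t) = ren S (fun a => a) (inst f s t).
Proof.
  rewrite (inst_ren _ _ _ _ _ (fun x => S (f x)) (up_lam s)) by reflexivity.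
  symmetry. now apply ren_inst.
Qed.

Lemma inst_up_mu f s t :
  inst f (up_mu s) (ren (fun x => x) S t) = ren (fun x => x) S (inst f s t).
Proof.
  rewrite (inst_ren _ _ _ _ _ f (ren_musubst (fun x => x) S s)) by reflexivity.
  symmetry. now apply ren_inst.
Qed.

(** The head of a frame list is innermost, so the frames of [s1], instantiated by [s], precede those
    that [s] attaches to the renamed variable. *)
Definition comp_musubst (f : nat -> nat) (s s1 : musubst) : musubst := fun a =>
  (fst (s (fst (s1 a))), map (map_frame (inst f s)) (snd (s1 a)) ++ snd (s (fst (s1 a)))).

Lemma inst_inst t : forall f s f1 s1 f2 s2,
  (forall x, f2 x = f (f1 x)) -> (forall a, s2 a = comp_musubst f s s1 a) ->
  inst f s (inst f1 s1 t) = inst f2 s2 t.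
Proof.
  induction t; simpl; intros f s f1 s1 f2 s2 Hf Hs; f_equal; auto.
  - apply IHt; [now apply up_comp|].
    intros a; unfold up_lam, ren_musubst; rewrite Hs; unfold comp_musubst; simpl.
    f_equal. rewrite map_app, !map_frame_map. f_equal.
    apply map_frame_ext. intros; symmetry; apply inst_up_lam.
  - apply IHt; auto.
    intros [|a]; simpl; auto; unfold ren_musubst; rewrite Hs.
    unfold comp_musubst, ren_musubst; simpl.
    f_equal. rewrite map_app, !map_frame_map. f_equal.
    apply map_frame_ext. intros; symmetry; apply inst_up_mu.
  - now rewrite Hs.
  - rewrite inst_plug, Hs; simpl; rewrite plug_app; do 2 f_equal; auto.
Qed.

(** Turns a contractum of an instance back into an instance, so that an induction on the
    uninstantiated term can apply. *)
Lemma contract_inst f s F t :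
  contract F (inst f (up_mu s) t) = inst f (extend s F) t.
Proof.
  apply inst_inst; auto.
  intros [|a]; simpl; auto.
  unfold ren_musubst, comp_musubst; simpl. rewrite app_nil_r, map_frame_map. f_equal.
  (* The frames of [s] have been lifted past the bound mu-variable, so contraction leaves them
     unchanged. *)
  apply map_frame_ext. intros u; symmetry.
  rewrite (inst_ren _ _ _ _ _ (fun x => x) (fun a => (S a, []))) by reflexivity.
  now apply inst_ren_nil.
Qed.

Lemma inst_contract f s F t :
  inst f (up_mu s) (contract F t) = contract (map_frame (inst f s) F) (inst f (up_mu s) t).
Proof.
  rewrite contract_inst.
  apply inst_inst; auto.
  intros [|a]; unfold comp_musubst; simpl; auto.
  do 2 f_equal. destruct F; simpl; f_equal; symmetry; apply inst_up_mu.
Qed.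

(** * Lifting and the two structural substitutions as instances of [ren] and [inst] *)

Lemma lift_lam_ren t : forall k f g,
  (forall x, f x = if x <? k then x else S x) -> (forall a, g a = a) ->
  lift_lam k t = ren f g t.
Proof.
  induction t; simpl; intros k f g Hf Hg; f_equal; auto.
  - apply IHt; auto. intros [|x]; simpl; auto. rewrite Hf.
    change (S x <? S k) with (x <? k). now destruct (x <? k).
  - apply IHt; auto using up_id.
Qed.

Lemma lift_mu_ren t : forall k f g,
  (forall x, f x = x) -> (forall a, g a = if a <? k then a else S a) ->
  lift_mu k t = ren f g t.
Proof.
  induction t; simpl; intros k f g Hf Hg; f_equal; auto.
  - apply IHt; auto using up_id.
  - apply IHt; auto. intros [|x]; simpl; auto. rewrite Hg.
    change (S x <? S k) with (x <? k). now destruct (x <? k).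
Qed.

Lemma lift_lam_0 t : lift_lam 0 t = ren S (fun a => a) t.
Proof. now apply lift_lam_ren. Qed.

Lemma lift_mu_0 t : lift_mu 0 t = ren (fun x => x) S t.
Proof. now apply lift_mu_ren. Qed.

Lemma subst_r_inst t : forall a N f s,
  (forall x, f x = x) -> (forall b, s b = (b, if b =? a then [ArgR N] else [])) ->
  subst_r a N t = inst f s t.
Proof.
  induction t; simpl; intros a N f s Hf Hs; f_equal; auto.
  - apply IHt; auto using up_id.
    intros b; unfold up_lam, ren_musubst; rewrite Hs, lift_lam_0; simpl.
    now destruct (b =? a).
  - apply IHt; auto.
    intros [|b]; simpl; auto; unfold ren_musubst; rewrite Hs, lift_mu_0; simpl.
    now destruct (b =? a).
  - rewrite Hs, <- (IHt a N f s Hf Hs). now destruct (n =? a).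
Qed.

Lemma subst_l_inst t : forall a N f s,
  (forall x, f x = x) -> (forall b, s b = (b, if b =? a then [ArgL N] else [])) ->
  subst_l a N t = inst f s t.
Proof.
  induction t; simpl; intros a N f s Hf Hs; f_equal; auto.
  - apply IHt; auto using up_id.
    intros b; unfold up_lam, ren_musubst; rewrite Hs, lift_lam_0; simpl.
    now destruct (b =? a).
  - apply IHt; auto.
    intros [|b]; simpl; auto; unfold ren_musubst; rewrite Hs, lift_mu_0; simpl.
    now destruct (b =? a).
  - rewrite Hs, <- (IHt a N f s Hf Hs). now destruct (n =? a).
Qed.

Lemma subst_r_contract N t : subst_r 0 (lift_mu 0 N) t = contract (ArgR N) t.
Proof.
  apply subst_r_inst; auto. intros [|b]; simpl; auto. now rewrite lift_mu_0.
Qed.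

Lemma subst_l_contract N t : subst_l 0 (lift_mu 0 N) t = contract (ArgL N) t.
Proof.
  apply subst_l_inst; auto. intros [|b]; simpl; auto. now rewrite lift_mu_0.
Qed.

(** * Reduction *)

Definition star : term -> term -> Prop := clos_refl_trans term red.
Definition sn : term -> Prop := Acc (fun t' t => red t t').

Lemma red_fill_Mu F t : red (fill F (Mu t)) (Mu (contract F t)).
Proof.
  destruct F; simpl.
  - rewrite <- subst_r_contract; constructor.
  - rewrite <- subst_l_contract; constructor.
Qed.

Lemma red_fill F t t' : red t t' -> red (fill F t) (fill F t').
Proof. destruct F; simpl; now constructor. Qed.

Lemma red_plug l t t' : red t t' -> red (plug l t) (plug l t').
Proof. revert t t'; induction l; simpl; auto using red_fill. Qed.

Lemma red_inst t t' : red t t' -> forall f s, red (inst f s t) (inst f s t').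
Proof.
  induction 1; intros f s; simpl; try (constructor; auto; fail).
  - rewrite subst_r_contract, inst_contract. apply (red_fill_Mu (ArgR _)).
  - rewrite subst_l_contract, inst_contract. apply (red_fill_Mu (ArgL _)).
  - constructor. now apply red_plug.
Qed.

Lemma star_map (h : term -> term) :
  (forall t t', red t t' -> red (h t) (h t')) ->
  forall t t', star t t' -> star (h t) (h t').
Proof.
  intros Hh t t' H; induction H.
  - apply rt_step; auto.
  - apply rt_refl.
  - eapply rt_trans; eauto.
Qed.

Lemma star_inst f s t t' : star t t' -> star (inst f s t) (inst f s t').
Proof. apply star_map. intros; now apply red_inst. Qed.

Lemma star_ren f g t t' : star t t' -> star (ren f g t) (ren f g t').
Proof.
  rewrite <- !(inst_ren_nil _ f (fun a => (g a, [])) g) by reflexivity.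
  apply star_inst.
Qed.

Lemma star_App t t' u u' : star t t' -> star u u' -> star (App t u) (App t' u').
Proof.
  intros Ht Hu. apply rt_trans with (App t' u).
  - apply (star_map (fun t => App t u)); auto using red_App_l.
  - apply (star_map (App t')); auto using red_App_r.
Qed.

(** * Reduction inside substituted frames *)

Inductive star_frame : frame -> frame -> Prop :=
| star_ArgR N N' : star N N' -> star_frame (ArgR N) (ArgR N')
| star_ArgL N N' : star N N' -> star_frame (ArgL N) (ArgL N').

Lemma star_frame_refl F : star_frame F F.
Proof. destruct F; constructor; apply rt_refl. Qed.

Lemma star_plug l l' :
  Forall2 star_frame l l' -> forall t t', star t t' -> star (plug l t) (plug l' t').
Proof.
  induction 1 as [|F F' l l' HF Hl IH]; simpl; auto.
  intros t t' Ht. apply IH. destruct HF; simpl; now apply star_App.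
Qed.

Definition star_musubst (s s' : musubst) : Prop :=
  forall a, fst (s a) = fst (s' a) /\ Forall2 star_frame (snd (s a)) (snd (s' a)).

Lemma star_ren_musubst f g s s' :
  star_musubst s s' -> star_musubst (ren_musubst f g s) (ren_musubst f g s').
Proof.
  intros H a; destruct (H a) as [E L]; simpl; split; [now rewrite E|].
  induction L as [|F F' l l' HF Hl IH]; simpl; constructor; auto.
  destruct HF; simpl; constructor; now apply star_ren.
Qed.

(** A frame is copied once per occurrence of its mu-variable, possibly never, so one step in a frame
    becomes any number of steps. *)
Lemma star_inst_musubst t : forall f s s',
  star_musubst s s' -> star (inst f s t) (inst f s' t).
Proof.
  induction t; simpl; intros f s s' H.
  - apply rt_refl.
  - apply (star_map Lam); auto using red_Lam.
    apply IHt. now apply star_ren_musubst.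
  - apply star_App; auto.
  - apply (star_map Mu); auto using red_Mu.
    apply IHt. intros [|a]; simpl; [now split|].
    now apply star_ren_musubst.
  - destruct (H n) as [E L]. rewrite E.
    apply (star_map (Name _)); auto using red_Name.
    apply star_plug; auto.
Qed.

Lemma star_contract F F' t t' :
  star_frame F F' -> star t t' -> star (contract F t) (contract F' t').
Proof.
  intros HF Ht. apply rt_trans with (contract F t'); [now apply star_inst|].
  apply star_inst_musubst. intros [|a]; simpl; split; auto.
  constructor; auto.
  destruct HF; simpl; constructor; now apply star_ren.
Qed.

(** * Reductions that end in a [Mu] *)

Definition inert (t : term) : Prop :=
  match t with App _ _ | Mu _ => False | _ => True end.

Lemma star_inert t t' : star t t' -> inert t -> inert t'.
Proof. induction 1 as [t t' H| |]; auto. destruct H; simpl; auto. Qed.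

Lemma star_Mu_inv t u : star (Mu t) u -> exists t', u = Mu t' /\ star t t'.
Proof.
  intros H. apply clos_rt_rt1n in H.
  remember (Mu t) as v eqn:E. revert t E.
  induction H as [|v v' w Hred _ IH]; intros t ->.
  - exists t; split; auto; apply rt_refl.
  - inversion Hred; subst. destruct (IH _ eq_refl) as (t'' & -> & H).
    exists t''; split; auto. eapply rt_trans; [apply rt_step|]; eauto.
Qed.

(** Some step must fire the head redex. Steps made earlier in the other argument can be postponed,
    because [contract] is monotone in its frame; hence the frame holds the original [u] or [t]. *)
Lemma star_App_Mu t u P : star (App t u) (Mu P) ->
  (exists Q, star t (Mu Q) /\ star (contract (ArgR u) Q) P) \/
  (exists Q, star u (Mu Q) /\ star (contract (ArgL t) Q) P).
Proof.
  intros H. apply clos_rt_rt1n in H.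
  remember (App t u) as v eqn:Ev. remember (Mu P) as w eqn:Ew.
  revert t u Ev P Ew. induction H as [|v v' w Hred Hstar IH]; intros t u -> P Ew.
  - discriminate.
  - inversion Hred; subst; clear Hred.
    + left. exists M. split; [apply rt_refl|]. rewrite <- subst_r_contract.
      apply clos_rt1n_rt, star_Mu_inv in Hstar.
      now destruct Hstar as (? & [= ->] & ?).
    + right. exists N. split; [apply rt_refl|]. rewrite <- subst_l_contract.
      apply clos_rt1n_rt, star_Mu_inv in Hstar.
      now destruct Hstar as (? & [= ->] & ?).
    + destruct (IH _ _ eq_refl _ eq_refl) as [(Q & HQ & HP)|(Q & HQ & HP)].
      * left; exists Q; split; auto. eapply rt_trans; [apply rt_step|]; eauto.
      * right; exists Q; split; auto. eapply rt_trans; [|exact HP].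
        apply star_contract; [|apply rt_refl]. constructor. now apply rt_step.
    + destruct (IH _ _ eq_refl _ eq_refl) as [(Q & HQ & HP)|(Q & HQ & HP)].
      * left; exists Q; split; auto. eapply rt_trans; [|exact HP].
        apply star_contract; [|apply rt_refl]. constructor. now apply rt_step.
      * right; exists Q; split; auto. eapply rt_trans; [apply rt_step|]; eauto.
Qed.

(* The frames of a substitution only occur below names, so they cannot create the
   head [Mu]. *)
Lemma star_inst_Mu t : forall f s P, star (inst f s t) (Mu P) ->
  exists Q, star t (Mu Q) /\ star (inst f (up_mu s) Q) P.
Proof.
  induction t; simpl; intros f s P H.
  - now apply star_inert in H.
  - now apply star_inert in H.
  - apply star_App_Mu in H as [(Q1 & H1 & H2)|(Q1 & H1 & H2)].
    + apply IHt1 in H1 as (Q & H3 & H4).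
      (* The head redex is fired in the uninstantiated application; [inst_contract] carries this to
         the instance. *)
      exists (contract (ArgR t2) Q). split.
      * eapply rt_trans; [apply star_App; [exact H3|apply rt_refl]|].
        apply rt_step, (red_fill_Mu (ArgR t2)).
      * rewrite inst_contract. eapply rt_trans; [|exact H2].
        apply star_contract; auto using star_frame_refl.
    + apply IHt2 in H1 as (Q & H3 & H4).
      exists (contract (ArgL t1) Q). split.
      * eapply rt_trans; [apply star_App; [apply rt_refl|exact H3]|].
        apply rt_step, (red_fill_Mu (ArgL t1)).
      * rewrite inst_contract. eapply rt_trans; [|exact H2].
        apply star_contract; auto using star_frame_refl.
  - apply star_Mu_inv in H as (t' & [= ->] & H).
    exists t. split; auto. apply rt_refl.
  - now apply star_inert in H.
Qed.

(** * Strong normalization *)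

Lemma sn_star t t' : star t t' -> sn t -> sn t'.
Proof. induction 1; auto. intros H'. now apply H'. Qed.

Lemma sn_Var x : sn (Var x).
Proof. constructor. intros t' H; inversion H. Qed.

Lemma sn_Lam t : sn t -> sn (Lam t).
Proof. induction 1 as [t _ IH]; constructor. intros t' H; inversion H; subst; now apply IH. Qed.

Lemma sn_Mu t : sn t -> sn (Mu t).
Proof. induction 1 as [t _ IH]; constructor. intros t' H; inversion H; subst; now apply IH. Qed.

Lemma sn_Name a t : sn t -> sn (Name a t).
Proof. induction 1 as [t _ IH]; constructor. intros t' H; inversion H; subst; now apply IH. Qed.

(** Only head contractions escape a double induction on [sn t] and [sn u]. The assumptions range
    over all [Mu] reducts so as to persist when [t] or [u] is reduced. *)
Lemma sn_App t u : sn t -> sn u ->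
  (forall P, star t (Mu P) -> sn (contract (ArgR u) P)) ->
  (forall P, star u (Mu P) -> sn (contract (ArgL t) P)) ->
  sn (App t u).
Proof.
  intros Ht; revert u; induction Ht as [t Ht IHt].
  intros u Hu; induction Hu as [u Hu IHu]. intros Hl Hr.
  constructor. intros v Hv; inversion Hv; subst.
  - rewrite subst_r_contract. apply sn_Mu, Hl, rt_refl.
  - rewrite subst_l_contract. apply sn_Mu, Hr, rt_refl.
  - apply IHt; auto.
    + now constructor.
    + intros P HP. apply Hl. eapply rt_trans; [apply rt_step|]; eauto.
    + intros P HP. apply (sn_star (contract (ArgL t) P)); auto.
      apply star_contract; [|apply rt_refl]. constructor. now apply rt_step.
  - apply IHu; auto.
    + intros P HP. apply (sn_star (contract (ArgR u) P)); auto.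
      apply star_contract; [|apply rt_refl]. constructor. now apply rt_step.
    + intros P HP. apply Hr. eapply rt_trans; [apply rt_step|]; eauto.
Qed.

(** * The well-founded order generated by reducts and subterms *)

Inductive subterm1 : term -> term -> Prop :=
| sub_Lam t : subterm1 t (Lam t)
| sub_App_l t u : subterm1 t (App t u)
| sub_App_r t u : subterm1 u (App t u)
| sub_Mu t : subterm1 t (Mu t)
| sub_Name a t : subterm1 t (Name a t).

Definition prec1 (t' t : term) : Prop := red t t' \/ subterm1 t' t.
Definition prec : term -> term -> Prop := clos_trans term prec1.

Lemma subterm1_red s t s' : subterm1 s t -> red s s' ->
  exists t', red t t' /\ subterm1 s' t'.
Proof. destruct 1; intros H; eexists; (split; [|econstructor]); now constructor. Qed.

Lemma subterm_red s t : clos_refl_trans _ subterm1 s t -> forall s', red s s' ->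
  exists t', red t t' /\ clos_refl_trans _ subterm1 s' t'.
Proof.
  induction 1 as [s t H|s|s t u _ IH1 _ IH2]; intros s' Hs.
  - destruct (subterm1_red _ _ _ H Hs) as (t' & ? & ?).
    exists t'; split; auto. now apply rt_step.
  - exists s'; split; auto. apply rt_refl.
  - destruct (IH1 _ Hs) as (t' & Ht & ?). destruct (IH2 _ Ht) as (u' & ? & ?).
    exists u'; split; auto. eapply rt_trans; eauto.
Qed.

(** A step in a subterm is a step of the whole term. So an outer induction on [sn t] handles reducts
    of any subterm, and an inner structural induction handles the descent to subterms. *)
Lemma sn_Acc_prec t : sn t -> Acc prec t.
Proof.
  intros H. apply Acc_clos_trans.
  cut (forall s, clos_refl_trans _ subterm1 s t -> Acc prec1 s).
  { intros K. apply K, rt_refl. }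
  induction H as [t _ IH].
  induction s; intros Hs; constructor; intros s' [Hred|Hsub];
    try (destruct (subterm_red _ _ Hs _ Hred) as (t' & Ht & Hs'); exact (IH _ Ht _ Hs'));
    inversion Hsub; subst;
    match goal with K : _ -> Acc _ ?x |- Acc _ ?x => apply K end;
    (eapply rt_trans; [apply rt_step|]; eassumption).
Qed.

Lemma prec_subterm1 s t : subterm1 s t -> prec s t.
Proof. intros; apply t_step; now right. Qed.

Lemma prec_star_Mu t u : star t (Mu u) -> prec u t.
Proof.
  intros H. apply clos_rt_rt1n in H. remember (Mu u) as v eqn:E.
  induction H as [|t t' v Hred _ IH]; subst.
  - apply prec_subterm1; constructor.
  - apply t_trans with t'; [exact (IH eq_refl)|]. apply t_step; now left.
Qed.

(** * Good frames *)

(** At most one frame per mu-variable: [extend] keeps this shape, and goodness concerns a single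
    frame around a term. *)
Definition frames_all (R : frame -> Prop) (s : musubst) : Prop :=
  forall a, snd (s a) = [] \/ exists F, snd (s a) = [F] /\ R F.

(** Quantifying over the renamings of [F] lets good frames go under binders. *)
Fixpoint good_acc (t : term) (H : Acc prec t) (F : frame) {struct H} : Prop :=
  forall f s,
    frames_all (fun G => forall t' (h : prec t' t), good_acc t' (Acc_inv H h) G) s ->
    forall f' g', sn (fill (map_frame (ren f' g') F) (inst f s t)).

(** Quantifying over the accessibility proof frees goodness from the proof on which [good_acc]
    recurses. *)
Definition good (t : term) (F : frame) : Prop :=
  forall H : Acc prec t, good_acc t H F.

Definition good_below (t : term) (F : frame) : Prop :=
  forall t', prec t' t -> good t' F.

Lemma frames_all_impl (R R' : frame -> Prop) s :
  (forall F, R F -> R' F) -> frames_all R s -> frames_all R' s.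
Proof. intros HR H a. destruct (H a) as [|(F & ? & ?)]; eauto. Qed.

Lemma good_acc_irrel t : Acc prec t -> forall (H H' : Acc prec t) F,
  good_acc t H F -> good_acc t H' F.
Proof.
  induction 1 as [t _ IH]. intros [H] [H'] F HF f s Hs f' g'.
  apply (HF f s). revert Hs. apply frames_all_impl. intros G HG t' h.
  exact (IH t' h _ _ G (HG t' h)).
Qed.

(** The intended recursive equation for goodness, free of accessibility proofs in its right-hand
    side. *)
Lemma good_iff t F : Acc prec t ->
  good t F <->
  (forall f s, frames_all (good_below t) s ->
   forall f' g', sn (fill (map_frame (ren f' g') F) (inst f s t))).
Proof.
  intros [A]. split.
  - intros HF f s Hs. apply (HF (Acc_intro _ A)).
    revert Hs. apply frames_all_impl. intros G HG t' h. apply HG, h.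
  - intros HF [H] f s Hs. apply HF. revert Hs. apply frames_all_impl.
    intros G HG t' h H'. exact (good_acc_irrel t' H' _ _ G (HG t' h)).
Qed.

Lemma good_below_prec t t' F : prec t' t -> good_below t F -> good_below t' F.
Proof. intros h HF u hu. apply HF. eapply t_trans; eauto. Qed.

Lemma good_below_ren t F f g : Acc prec t ->
  good_below t F -> good_below t (map_frame (ren f g) F).
Proof.
  intros [A] HF t' h. specialize (HF t' h). apply (good_iff _ _ (A _ h)).
  rewrite (good_iff _ _ (A _ h)) in HF.
  intros f1 s Hs f' g'.
  replace (map_frame (ren f' g') (map_frame (ren f g) F))
    with (map_frame (ren (fun x => f' (f x)) (fun a => g' (g a))) F).
  - now apply HF.
  - destruct F; simpl; f_equal; symmetry; now apply ren_ren.
Qed.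

Lemma frames_good_prec t t' s : prec t' t ->
  frames_all (good_below t) s -> frames_all (good_below t') s.
Proof. intros h. apply frames_all_impl. intros F. now apply good_below_prec. Qed.

Lemma frames_good_ren t s f g : Acc prec t ->
  frames_all (good_below t) s -> frames_all (good_below t) (ren_musubst f g s).
Proof.
  intros A H a; simpl. destruct (H a) as [->|(F & -> & HF)]; simpl; auto.
  right; eexists; split; [reflexivity|]. now apply good_below_ren.
Qed.

Lemma frames_good_up_mu t s : Acc prec t ->
  frames_all (good_below t) s -> frames_all (good_below t) (up_mu s).
Proof. intros A H [|a]; simpl; auto. now apply frames_good_ren. Qed.

Lemma frames_good_extend t s F : Acc prec t ->
  frames_all (good_below t) s -> good_below t F ->
  frames_all (good_below t) (extend s F).
Proof.
  intros A H HF [|a]; simpl.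
  - right; eexists; split; [reflexivity|]. now apply good_below_ren.
  - now apply (frames_good_up_mu t s A H (S a)).
Qed.

(** * Normalization of instances and of their applications *)

Lemma sn_inst t : Acc prec t ->
  forall f s, frames_all (good_below t) s -> sn (inst f s t).
Proof.
  induction 1 as [t A IH]. intros f s Hs.
  pose proof (Acc_intro _ A) as At.
  assert (IHs : forall u, subterm1 u t -> forall f' s',
            frames_all (good_below t) s' -> sn (inst f' s' u)).
  { intros u Hu f' s' Hs'. apply prec_subterm1 in Hu.
    apply IH; auto. now apply (frames_good_prec t). }
  destruct t as [x|t|t u|t|a t]; simpl.
  - apply sn_Var.
  - apply sn_Lam, IHs; [constructor|]. now apply frames_good_ren.
  (* The body of a [Mu] reduct of the application is below it for [prec], so the induction
     hypothesis covers each head contractum once it is seen as an instance of such a body. *)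
  - assert (IHc : forall Q, star (App t u) (Mu Q) -> sn (inst f (up_mu s) Q)).
    { intros Q HQ. apply prec_star_Mu in HQ.
      apply IH; auto. apply (frames_good_prec (App t u)); auto.
      now apply frames_good_up_mu. }
    apply sn_App; try (apply IHs; [constructor|assumption]); intros P HP;
      apply star_inst_Mu in HP as (Q & HQ & HP);
      eapply sn_star; try (apply star_contract; [apply star_frame_refl|exact HP]).
    + change (ArgR (inst f s u)) with (map_frame (inst f s) (ArgR u)).
      rewrite <- inst_contract. apply IHc.
      eapply rt_trans; [apply star_App; [exact HQ|apply rt_refl]|].
      apply rt_step, (red_fill_Mu (ArgR u)).
    + change (ArgL (inst f s t)) with (map_frame (inst f s) (ArgL t)).
      rewrite <- inst_contract. apply IHc.
      eapply rt_trans; [apply star_App; [apply rt_refl|exact HQ]|].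
      apply rt_step, (red_fill_Mu (ArgL t)).
  - apply sn_Mu, IHs; [constructor|]. now apply frames_good_up_mu.
  - apply sn_Name. destruct (Hs a) as [->|(F & -> & HF)]; simpl.
    + apply IHs; auto; constructor.
    (* The frame is good for the argument of the name, which is exactly what is put inside it. *)
    + assert (h : prec t (Name a t)) by (apply prec_subterm1; constructor).
      specialize (HF _ h). rewrite (good_iff _ _ (A _ h)) in HF.
      replace F with (map_frame (ren (fun x => x) (fun x => x)) F).
      * apply HF. now apply (frames_good_prec (Name a t)).
      * destruct F; simpl; f_equal; now apply ren_id.
Qed.

Lemma sn_App_inst t : Acc prec t -> forall u, Acc prec u ->
  forall f s f' s',
  frames_all (good_below t) s -> frames_all (good_below u) s' ->
  sn (App (inst f s t) (inst f' s' u)).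
Proof.
  induction 1 as [t At IHt]. induction 1 as [u Au IHu]. intros f s f' s' Hs Hs'.
  pose proof (Acc_intro _ At) as At'. pose proof (Acc_intro _ Au) as Au'.
  apply sn_App; try (now apply sn_inst); intros P HP;
    apply star_inst_Mu in HP as (Q & HQ & HP); apply prec_star_Mu in HQ;
    eapply sn_star; try (apply star_contract; [apply star_frame_refl|exact HP]);
    rewrite contract_inst.
  - apply sn_inst; [now apply At|].
    apply (frames_good_prec t); auto. apply frames_good_extend; auto.
    (* The frame built from [u] is good below [t] by the hypothesis for the pairs [(t', u)]; its
       renaming is absorbed into the substitution applied to [u]. *)
    intros t' h. apply (good_iff _ _ (At _ h)). intros f1 s1 Hs1 f2 g2; simpl.
    rewrite (ren_inst _ f2 g2 _ _ (fun x => f2 (f' x)) (ren_musubst f2 g2 s')) by reflexivity.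
    apply IHt; auto. now apply frames_good_ren.
  - apply sn_inst; [now apply Au|].
    apply (frames_good_prec u); auto. apply frames_good_extend; auto.
    (* Symmetrically, the frame built from [t] is good below [u], by the inner hypothesis with [t]
       fixed. *)
    intros t' h. apply (good_iff _ _ (Au _ h)). intros f1 s1 Hs1 f2 g2; simpl.
    rewrite (ren_inst _ f2 g2 _ _ (fun x => f2 (f x)) (ren_musubst f2 g2 s)) by reflexivity.
    apply IHu; auto. now apply frames_good_ren.
Qed.

Lemma sn_all t : sn t.
Proof.
  induction t; auto using sn_Var, sn_Lam, sn_Mu, sn_Name.
  (* Both sides are written as instances under the identity, which attaches no frames, so the
     goodness conditions hold trivially. *)
  rewrite <- (ren_id t1 (fun x => x) (fun a => a)), <- (ren_id t2 (fun x => x) (fun a => a))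
    by reflexivity.
  rewrite <- !(inst_ren_nil _ _ id_musubst) by reflexivity.
  apply sn_App_inst; try (now apply sn_Acc_prec); intros a; now left.
Qed.

Theorem theorem10 : forall t : term, strongly_normalizing t.
Proof.
  intros t (f & Hf & Hred).
  (* The position [n] is generalized so that the induction can move along the sequence. *)
  assert (H : forall u, sn u -> forall n, f n = u -> False).
  { induction 1 as [u _ IH]. intros n <-. exact (IH _ (Hred n) (S n) eq_refl). }
  exact (H t (sn_all t) 0 Hf).
Qed.
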